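(* Let $G$ be a finite simple graph with vertex set $\{x_1,\dots,x_n\}$ and let $S=\mathbb{K}[x_1,\dots,x_n]$ over a field $\mathbb{K}$. Then: (1) $\operatorname{depth}_S I(G)^2\geq \alpha_2(G)-2$; (2) if $G$ is $W(K_3)$-free, then $\operatorname{depth}_S I(G)^2\geq \alpha_2(G)-1$; (3) if $G$ is triangle-free, then $\operatorname{depth}_S I(G)^2\geq \alpha_2(G)$.
   Context: Vertices of $G$ are identified with the variables of $S$. The edge ideal is $I(G)=(x_ix_j : x_ix_j\in E(G))\subseteq S$. For a homogeneous ideal $I$, $\operatorname{depth}_S I$ denotes the depth of $I$ as an $S$-module. For a vertex $x$, $N_G(x)$ is its set of neighbours and $N_G[x]=N_G(x)\cup\{x\}$. The star with center $x$, $\mathrm{St}(x)$, is the subgraph with vertex set $N_G[x]$ and edges $\{xy: y\in N_G(x)\}$. A star packing of $G$ is a family of stars of $G$ whose vertex sets are pairwise disjoint; the star packing number $\alpha_2(G)$ is the maximum size of a star packing of $G$. A whiskered triangle $W(K_3)$ is the graph obtained from a triangle $K_3$ by attaching a pendant edge (an edge to a new vertex of degree one) at each of its three vertices. $G$ is $H$-free if it has no induced subgraph isomorphic to $H$; triangle-free means $K_3$-free. *)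

(* Defs.v *)
From mathcomp Require Import all_boot all_order all_algebra.
From mathcomp Require Import mpoly.
Set Implicit Arguments. Unset Strict Implicit. Unset Printing Implicit Defensive.
Import GRing.Theory.
Local Open Scope ring_scope.

Definition simple_graph (n : nat) (e : rel 'I_n) : Prop :=
  (forall x y, e x y = e y x) /\ (forall x, ~~ e x x).

Definition closed_nbhd (n : nat) (e : rel 'I_n) (x : 'I_n) : {set 'I_n} :=
  [set y | (y == x) || e x y].

(* a star packing, given by the set of centres: the vertex sets N_G[x]
   of the stars St(x) are pairwise disjoint *)
Definition star_packing (n : nat) (e : rel 'I_n) (C : {set 'I_n}) : bool :=
  [forall x in C, forall y in C,
     (x != y) ==> [disjoint closed_nbhd e x & closed_nbhd e y]].

Definition alpha2 (n : nat) (e : rel 'I_n) : nat :=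
  \max_(C : {set 'I_n} | star_packing e C) #|C|.

Definition has_induced (m n : nat) (h : rel 'I_m) (e : rel 'I_n) : Prop :=
  exists f : 'I_m -> 'I_n, injective f /\ forall a b, e (f a) (f b) = h a b.

Definition H_free (m n : nat) (h : rel 'I_m) (e : rel 'I_n) : Prop :=
  ~ has_induced h e.

Definition K3 : rel 'I_3 := fun a b => a != b.

(* whiskered triangle W(K_3): triangle 0,1,2 with pendant edges 0-3, 1-4, 2-5 *)
Definition WK3_edge (a b : nat) : bool :=
  [|| (a < 3)%N && (b < 3)%N && (a != b),
      (b == a + 3) && (a < 3) | (a == b + 3) && (b < 3) ]%N.
Definition WK3 : rel 'I_6 := fun a b => WK3_edge a b.

Section Alg.
Variables (n : nat) (K : fieldType).
Local Notation S := {mpoly K[n]}.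

Definition edge_monomials (e : rel 'I_n) : seq S :=
  [seq 'X_p.1 * 'X_p.2 |
     p <- [seq q <- [seq (i, j) | i <- enum 'I_n, j <- enum 'I_n] | e q.1 q.2]].

Definition in_ideal (gs : seq S) (p : S) : Prop :=
  exists c : nat -> S, p = \sum_(i < size gs) c i * gs`_i.

Definition edge_ideal_sq (e : rel 'I_n) : S -> Prop :=
  in_ideal [seq a * b | a <- edge_monomials e, b <- edge_monomials e].

Definition ideal_times (fs : seq S) (M : S -> Prop) (p : S) : Prop :=
  exists m : nat -> S, (forall j, (j < size fs)%N -> M (m j)) /\
    p = \sum_(j < size fs) fs`_j * m j.

Definition in_max_ideal (f : S) : Prop := f@_0%MM = 0.

(* fs is an M-regular sequence: each f_i is a nonzerodivisor on
   M / (f_1..f_{i-1}) M, and M / (f_1..f_k) M <> 0 *)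
Definition regular_seq (fs : seq S) (M : S -> Prop) : Prop :=
  (forall i, (i < size fs)%N -> forall m, M m ->
     ideal_times (take i fs) M (fs`_i * m) -> ideal_times (take i fs) M m)
  /\ exists m, M m /\ ~ ideal_times fs M m.

(* depth_S M >= d : M = 0 (depth +oo), or there is an M-regular sequence of
   length d in the graded maximal ideal (depth = sup of such lengths). *)
Definition depth_ge (M : S -> Prop) (d : nat) : Prop :=
  (forall p, M p -> p = 0) \/
  exists fs : seq S, size fs = d /\ (forall f, f \in fs -> in_max_ideal f)
                     /\ regular_seq fs M.

End Alg.

(* Main.v *)
(** Let [C] be the set of centres of a maximum star packing and [f_x], for [x] in
[C], the sum of the variables in [N[x]].  The elementary symmetric functions
[E_1, ..., E_d] of the [f_x] form a regular sequence on [S / P], for every prime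
[P] generated by variables, as soon as at least [d] of the sets [N[x]] are not
contained in [P]; unlike generic linear combinations of the [f_x], they work over
any field and for every choice of the surviving [f_x].  Regularity of this fixed
sequence passes through extensions, so [S / I(G)^2] is filtered, by repeatedly
using [0 -> S / (J : u) -> S / J -> S / (J + (u)) -> 0] for monomials [u], down to
quotients [S / P] which contain few of the [N[x]].  For [I(G)] none is contained.
The remaining quotients have [u] an edge [ab]: then at most one is lost if [a],
[b] have no common neighbour alive, and otherwise the quotients by the
neighbourhood of a triangle [abz] lose at most three, two if [G] is
[W(K_3)]-free, since three distinct centres adjacent to [a], [b], [z] induce a
whiskered triangle.  Finally [E_1, ..., E_{d+1}] is regular on the ideal [I(G)^2]
if [E_1, ..., E_d] is regular on [S / I(G)^2] and [E_1, ..., E_{d+1}] on [S]. *)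

Require Import Defs.
From mathcomp Require Import all_boot all_order all_algebra.
From mathcomp Require Import mpoly.
From mathcomp Require Import zify ring.

Set Implicit Arguments.
Unset Strict Implicit.
Unset Printing Implicit Defensive.

Import GRing.Theory.
Local Open Scope ring_scope.

(** * Weakly regular sequences on subquotients *)

Section WeaklyRegular.
Variable R : comNzRingType.
Implicit Types (A B C J : R -> Prop) (gs : seq R) (g r x y : R).

Definition ideal A :=
  [/\ A 0, forall x y, A x -> A y -> A (x + y) & forall r x, A x -> A (r * x)].

Definition whole : R -> Prop := fun=> True.

Definition mul_add g A B : R -> Prop :=
  fun p => exists a b, [/\ A a, B b & p = g * a + b].

Definition mul_addl gs A B : R -> Prop :=
  foldl (fun B' g => mul_add g A B') B gs.

Definition nonzerodiv A B g := forall m, A m -> B (g * m) -> B m.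

(* [gs] is weakly regular on the module [A / B]; the module is replaced by
   [A / (g A + B)] after each element [g]. *)
Fixpoint wreg A B gs : Prop :=
  if gs is g :: gs' then nonzerodiv A B g /\ wreg A (mul_add g A B) gs' else True.

Lemma ideal0 A : ideal A -> A 0. Proof. by case. Qed.
Lemma idealD A x y : ideal A -> A x -> A y -> A (x + y). Proof. by case=> _ + _; apply. Qed.
Lemma idealMl A r x : ideal A -> A x -> A (r * x). Proof. by case=> _ _; apply. Qed.
Lemma idealN A x : ideal A -> A x -> A (- x).
Proof. by move=> iA Ax; rewrite -mulN1r; apply: idealMl. Qed.
Lemma idealB A x y : ideal A -> A x -> A y -> A (x - y).
Proof. by move=> iA Ax Ay; apply: idealD => //; apply: idealN. Qed.
Lemma idealBr A x y : ideal A -> A y -> A (x - y) -> A x.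
Proof. by move=> iA Ay Axy; rewrite -(subrK y x); apply: idealD. Qed.

Lemma ideal_sum A (I : Type) (s : seq I) (P : pred I) (F : I -> R) :
  ideal A -> (forall i, P i -> A (F i)) -> A (\sum_(i <- s | P i) F i).
Proof.
move=> iA AF; elim/big_ind: _ => //; first exact: ideal0.
by move=> x y; apply: idealD.
Qed.

Lemma ideal_whole : ideal whole. Proof. by []. Qed.

Lemma ideal_mul_add g A B : ideal A -> ideal B -> ideal (mul_add g A B).
Proof.
move=> iA iB; split.
- by exists 0, 0; split; rewrite ?mulr0 ?addr0 //; apply: ideal0.
- move=> _ _ [a [b [Aa Bb ->]]] [c [d [Ac Bd ->]]].
  by exists (a + c), (b + d); split; [exact: idealD|exact: idealD|ring].
- move=> r _ [a [b [Aa Bb ->]]].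
  by exists (r * a), (r * b); split; [exact: idealMl|exact: idealMl|ring].
Qed.

Lemma sub_mul_add g A B x : ideal A -> B x -> mul_add g A B x.
Proof. by move=> iA Bx; exists 0, x; split; rewrite ?mulr0 ?add0r //; apply: ideal0. Qed.

Lemma ideal_mul_addl gs A B : ideal A -> ideal B -> ideal (mul_addl gs A B).
Proof.
by elim: gs B => //= g gs IH B iA iB; apply: IH => //; apply: ideal_mul_add.
Qed.

Lemma sub_mul_addl gs A B x : ideal A -> B x -> mul_addl gs A B x.
Proof.
by elim: gs B => //= g gs IH B iA Bx; apply: IH => //; apply: sub_mul_add.
Qed.

Lemma wreg_rcons gs g A B :
  wreg A B (rcons gs g) <-> wreg A B gs /\ nonzerodiv A (mul_addl gs A B) g.
Proof.
by elim: gs B => [|h gs IH] B /=; [tauto | have := IH (mul_add h A B); tauto].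
Qed.

(* Multiplication by [u] induces an isomorphism [A / B -> A' / B']. *)
Lemma wreg_iso u A B A' B' gs :
    ideal A -> ideal B -> ideal A' -> ideal B' ->
    (forall a, A a -> A' (u * a)) ->
    (forall a, A a -> B' (u * a) <-> B a) ->
    (forall a', A' a' -> exists a, A a /\ B' (a' - u * a)) ->
  wreg A B gs <-> wreg A' B' gs.
Proof.
move=> iA + iA' + AA' + +; elim: gs B B' => //= g gs IH B B' iB iB' BB' cov.
have up a (Aa : A a) : B a -> B' (u * a) by case: (BB' _ Aa).
have down a (Aa : A a) : B' (u * a) -> B a by case: (BB' _ Aa).
suff -> : wreg A (mul_add g A B) gs <-> wreg A' (mul_add g A' B') gs.
  split=> -[nzd w]; split=> //.
  - move=> m' Am' Bgm'; have [a [Aa Ba]] := cov _ Am'.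
    apply: (idealBr _ _ Ba) => //; apply: up => //; apply: (nzd a Aa).
    apply: down; first exact: idealMl.
    have -> : u * (g * a) = g * m' - g * (m' - u * a) by ring.
    by apply: idealB => //; apply: idealMl.
  - move=> m Am Bgm; apply: down => //; apply: (nzd _ (AA' _ Am)).
    have -> : g * (u * m) = u * (g * m) by ring.
    by apply: up => //; apply: idealMl.
apply: IH; [exact: ideal_mul_add|exact: ideal_mul_add| |].
- move=> a Aa; split.
  + move=> [a' [b' [Aa' Bb' e]]]; have [a2 [Aa2 Ba2]] := cov _ Aa'.
    have Ad : A (a - g * a2) by apply: idealB => //; apply: idealMl.
    exists a2, (a - g * a2); split=> //; last by ring.
    apply: down => //.
    have -> : u * (a - g * a2) = g * (a' - u * a2) + b' by rewrite mulrBr e; ring.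
    by apply: idealD => //; apply: idealMl.
  + move=> [a2 [b [Aa2 Bb e]]]; exists (u * a2), (u * b); split.
    * exact: AA'.
    * apply: up => //; have -> : b = a - g * a2 by rewrite e; ring.
      by apply: idealB => //; apply: idealMl.
    * by rewrite e; ring.
- move=> a' Aa'; have [a [Aa Ba]] := cov _ Aa'.
  by exists a; split=> //; apply: sub_mul_add.
Qed.

Lemma wreg_eq B B' gs : ideal B -> ideal B' -> (forall x, B x <-> B' x) ->
  wreg whole B gs <-> wreg whole B' gs.
Proof.
move=> iB iB' BB'; apply: (@wreg_iso 1) => // [a _|a' _]; first by rewrite mul1r; split=> /BB'.
by exists a'; split=> //; rewrite mul1r subrr; apply: ideal0.
Qed.

(** The sequence [0 -> B / C -> A / C -> A / B -> 0] stays exact modulo [g]: since [g] is a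
    nonzerodivisor on [A / B], [B] meets [g A + C] in [g B + C], so [(g A + B) / (g A + C)] is
    isomorphic to [B / (g B + C)]. *)
Lemma wreg_ext A B C gs : ideal A -> ideal B -> ideal C ->
    (forall x, B x -> A x) -> (forall x, C x -> B x) ->
  wreg A B gs -> wreg B C gs -> wreg A C gs.
Proof.
move=> iA; elim: gs B C => //= g gs IH B C iB iC BA CB [nAB wAB] [nBC wBC]; split.
  by move=> m Am Cgm; apply: (nBC m) => //; apply: (nAB m) => //; apply: CB.
apply: (IH (mul_add g A B)) => //; try exact: ideal_mul_add.
- move=> _ [a [b [Aa Bb ->]]].
  by apply: idealD => //; [apply: idealMl | apply: BA].
- by move=> _ [a [c [Aa Cc ->]]]; exists a, c; split=> //; apply: CB.
- refine (iffLR (@wreg_iso 1 B (mul_add g B C) _ _ gs _ _ _ _ _ _ _) wBC) => //;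
    try exact: ideal_mul_add.
  + by move=> b Bb; rewrite mul1r; apply: sub_mul_add.
  + move=> b Bb; rewrite mul1r; split=> -[a [c [Aa Cc e]]]; exists a, c; split=> //.
      apply: (nAB a) => //; have -> : g * a = b - c by rewrite e; ring.
      by apply: idealB => //; apply: CB.
    exact: BA.
  + move=> _ [a [b [Aa Bb ->]]]; exists b; split=> //.
    by exists a, 0; split=> //; [exact: ideal0 | ring].
Qed.

(* The depth lemma for [0 -> J / D -> R / D -> R / J -> 0]. *)
Lemma wreg_ideal_rcons J D gs g : ideal J -> ideal D -> (forall x, D x -> J x) ->
  wreg whole J gs -> wreg whole D (rcons gs g) -> wreg J D (rcons gs g).
Proof.
elim: gs J D => [|h gs IH] J D iJ iD DJ /=.
  by move=> _ [nzd _]; split=> // m _; apply: (nzd m).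
move=> [nJ wJ] [nD wD]; split; first by move=> m _; apply: (nD m).
have [iJ' iD'] : ideal (mul_add h whole J) /\ ideal (mul_add h whole D).
  by split; apply: ideal_mul_add.
(* As [h] is a nonzerodivisor on [R / J], the module [J / (h J + D)] is isomorphic to
   [(h R + J) / (h R + D)], to which induction applies. *)
have w : wreg (mul_add h whole J) (mul_add h whole D) (rcons gs g).
  apply: IH => //.
  by move=> _ [a [c [_ Cc ->]]]; exists a, c; split=> //; apply: DJ.
refine (iffRL (@wreg_iso 1 _ _ _ _ _ _ _ _ _ _ _ _) w) => //;
  first exact: ideal_mul_add.
- by move=> b Bb; rewrite mul1r; apply: sub_mul_add.
- move=> b Bb; rewrite mul1r; split=> -[a [c [Aa Cc e]]]; exists a, c; split=> //.
  apply: (nJ a) => //; have -> : h * a = b - c by rewrite e; ring.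
  by apply: idealB => //; apply: DJ.
- move=> _ [a [b [Aa Bb ->]]]; exists b; split=> //.
  by exists a, 0; split=> //; [exact: ideal0 | ring].
Qed.

(** An exchange argument: if [z m = g a + b], regularity of [g] modulo [z] gives [a = z a' + b'], so
    [z (m - g a')] lies in [B], hence so does [m - g a']. *)
Lemma nonzerodiv_mul_addl gs B z : ideal B -> nonzerodiv whole B z ->
    wreg whole B gs -> wreg whole (mul_add z whole B) gs ->
  nonzerodiv whole (mul_addl gs whole B) z.
Proof.
elim: gs B => //= g gs IH B iB nz [ng wg] [ngz wgz].
have iB' := ideal_mul_add g ideal_whole iB.
have iB'' := ideal_mul_add z ideal_whole iB.
apply: IH => //.
- move=> m _ [a [b [_ Bb e]]].
  have [|a' [b' [_ Bb' e']]] := ngz a I.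
    by exists m, (- b); split=> //; [exact: idealN | rewrite e; ring].
  exists a', (m - g * a'); split=> //; last by ring.
  apply: (nz _ I); have -> : z * (m - g * a') = g * b' + b by rewrite mulrBr e e'; ring.
  by apply: idealD => //; apply: idealMl.
- refine (iffLR (wreg_eq _ _ _ _) wgz); try exact: ideal_mul_add.
  move=> x; split=> -[a [_ [_ [b [c [_ Bc ->]]] ->]]].
    exists b, (g * a + c); split=> //; last by ring.
    by exists a, c.
  exists b, (z * a + c); split=> //; last by ring.
  by exists a, c.
Qed.

Lemma nonzerodivM B g h : nonzerodiv whole B g -> nonzerodiv whole B h ->
  nonzerodiv whole B (g * h).
Proof. by move=> ng nh m _; rewrite -mulrA => /(ng _ I) /(nh _ I). Qed.

End WeaklyRegular.

Arguments whole {R}.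

(** * Monomial ideals and graded ideals of polynomial rings *)

Section MonomialIdeals.
Variables (n : nat) (K : fieldType).
Local Notation S := {mpoly K[n]}.
Implicit Types (Q : 'X_{1..n} -> Prop) (B : S -> Prop) (gs : seq S) (p : S).
Implicit Types (m u : 'X_{1..n}).

(** Iterating [mul_add] from the zero ideal produces exactly the spans [ideal_times] of the
    prefixes; only the nonvanishing of the last quotient has to be supplied. *)
Lemma regular_seq_wreg gs B : ideal B -> wreg B (fun p => p = 0) gs ->
  (exists p, B p /\ ~ ideal_times gs B p) -> regular_seq gs B.
Proof.
move=> iB w ex; split=> //.
have i0 : ideal (fun p : S => p = 0).
  by split=> // [x y -> ->|r x ->]; rewrite ?addr0 ?mulr0.
have spanE (hs : seq S) p : mul_addl hs B (fun p => p = 0) p <-> ideal_times hs B p.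
  elim/last_ind: hs p => [|hs h IH] p.
    split=> [->|[c [_ ->]]]; last by rewrite big_ord0.
    by exists (fun=> 0); split=> //; rewrite big_ord0.
  rewrite /mul_addl foldl_rcons -/(mul_addl _ _ _); split.
    move=> [a [b [Ba /IH [c [Bc ->]] ->]]].
    exists (fun j => if (j < size hs)%N then c j else a); split.
      by move=> j _; case: ifP => // /Bc.
    rewrite size_rcons big_ord_recr /= nth_rcons !ltnn eqxx addrC.
    by congr (_ + _); apply: eq_bigr => j _; rewrite nth_rcons ltn_ord.
  rewrite /ideal_times size_rcons => -[c [Bc ->]].
  exists (c (size hs)), (\sum_(j < size hs) hs`_j * c j); split.
  - exact: Bc.
  - by apply/IH; exists c; split=> // j lj; apply: Bc; apply: ltnW.
  - rewrite big_ord_recr /= nth_rcons ltnn eqxx addrC.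
    by congr (_ + _); apply: eq_bigr => j _; rewrite nth_rcons ltn_ord.
have nzd (hs : seq S) D : wreg B D hs -> forall i, (i < size hs)%N ->
    nonzerodiv B (mul_addl (take i hs) B D) hs`_i.
  elim: hs D => //= h hs IH D [nz wh] [|i] //= li; exact: IH.
move=> i li p Bp /spanE Hp; apply/spanE; exact: nzd Hp.
Qed.

(** Monomial ideals are handled through predicates on exponents, so that a colon by a monomial [u]
    is the shift of [Q] by [u]. *)
Definition mideal Q p := forall m, m \in msupp p -> Q m.

Definition upward Q := forall m m', Q m -> Q (m + m')%MM.

Lemma ideal_mideal Q : upward Q -> ideal (mideal Q).
Proof.
move=> uQ; split.
- by move=> m; rewrite msupp0.
- by move=> x y Qx Qy m /msuppD_le; rewrite mem_cat => /orP[/Qx|/Qy].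
- move=> r x Qx m /msuppM_le/allpairsP[[m1 m2] /= [_ /Qx Q2 ->]].
  by rewrite addmC; apply: uQ.
Qed.

Lemma mideal_mulX Q u p :
  mideal Q ('X_[u] * p) <-> mideal (fun m => Q (m + u)%MM) p.
Proof.
split=> Qp m.
  move=> mp; apply: Qp; rewrite mulrC (perm_mem (msuppMX _ _)).
  by apply/mapP; exists m => //; rewrite addmC.
rewrite mulrC (perm_mem (msuppMX _ _)) => /mapP[m' m'p ->].
by rewrite addmC; apply: Qp.
Qed.

Lemma mideal_split Q u p : mideal (fun m => Q m \/ (u <= m)%MM) p ->
  exists a, mideal Q (p - 'X_[u] * a).
Proof.
move=> Qp; exists (\sum_(m <- msupp p | (u <= m)%MM) p@_m *: 'X_[m - u]).
have -> : 'X_[u] * (\sum_(m <- msupp p | (u <= m)%MM) p@_m *: 'X_[m - u]) =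
          \sum_(m <- msupp p | (u <= m)%MM) p@_m *: 'X_[m].
  rewrite mulr_sumr; apply: eq_bigr => m le_um.
  by rewrite -scalerAr -mpolyXD addmC submK.
have {1}-> : p = \sum_(m <- msupp p | (u <= m)%MM) p@_m *: 'X_[m]
                + \sum_(m <- msupp p | ~~ (u <= m)%MM) p@_m *: 'X_[m].
  by rewrite {1}[p]mpolyE (bigID (fun m => (u <= m)%MM)).
rewrite addrC addKr.
move=> m /msupp_sum_le/flatten_mapP[m']; rewrite mem_filter => /andP[nle m'p].
move=> /msuppZ_le; rewrite msuppX mem_seq1 => /eqP->.
by case: (Qp _ m'p) => // le; rewrite le in nle.
Qed.

Definition mwreg gs Q := wreg whole (mideal Q) gs.

Lemma mwreg_eq gs Q Q' : upward Q -> (forall m, Q m <-> Q' m) ->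
  mwreg gs Q -> mwreg gs Q'.
Proof.
move=> uQ QQ' w; have uQ' : upward Q' by move=> m m' /QQ' Qm; apply/QQ'; apply: uQ.
refine (iffLR (wreg_eq _ _ _ _) w); [exact: ideal_mideal|exact: ideal_mideal|].
by move=> p; split=> Qp m mp; apply/QQ'; apply: Qp.
Qed.

Lemma mwreg_full gs Q : Q 0%MM -> upward Q -> mwreg gs Q.
Proof.
move=> Q0 uQ; have {Q0} QT m : Q m by rewrite -[m]add0m; apply: uQ.
suff wT (D : S -> Prop) : (forall p, D p) -> wreg whole D gs by apply: wT => p m _.
elim: gs D => [|g gs IH] D DT //=; split; first by move=> *; apply: DT.
by apply: IH => p; exists 0, p; split=> //; rewrite mulr0 add0r.
Qed.

(* The exact sequence [0 -> S / (J : u) -> S / J -> S / (J + (u)) -> 0]. *)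
Lemma mwreg_colon gs Q u : upward Q ->
  mwreg gs (fun m => Q (m + u)%MM) -> mwreg gs (fun m => Q m \/ (u <= m)%MM) ->
  mwreg gs Q.
Proof.
move=> uQ wc wa.
have iu : ideal (mideal (fun m => Q m \/ (u <= m)%MM)).
  apply: ideal_mideal => m m' [Qm|le]; [left; exact: uQ | right].
  exact: lepm_trans le (lem_addr _ _).
have ic : ideal (mideal (fun m => Q (m + u)%MM)).
  by apply: ideal_mideal => m m' Qm; rewrite -addmA (addmC m') addmA; apply: uQ.
apply: wreg_ext wa _ => //; first exact: ideal_mideal.
- by move=> p Qp m /Qp; left.
refine (iffLR (@wreg_iso _ 'X_[u] _ _ _ _ _ _ _ _ _ _ _ _) wc) => //.
- exact: ideal_mideal.
- move=> a _ m; rewrite mulrC (perm_mem (msuppMX _ _)) => /mapP[m' _ ->].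
  by right; apply: lem_addr.
- by move=> a _; apply: mideal_mulX.
- by move=> p /mideal_split[a Qa]; exists a.
Qed.

(** * Graded ideals *)

Definition graded B := forall p d, B p -> B (pihomog mdeg d p).

Lemma pihomogM g p d e : g \is d.-homog ->
  pihomog mdeg e (g * p) = g * (if (d <= e)%N then pihomog mdeg (e - d) p else 0).
Proof.
move=> hg; pose k := maxn (msize p) e.+1.
rewrite {1}(@pihomog_partitionE _ _ mdeg k p) ?leq_maxl // mulr_sumr raddf_sum /=.
have hom i : g * pihomog mdeg i p \is (d + i).-homog by apply/dhomogM/pihomogP.
case: leqP => lde.
  have lt : (e - d < k)%N by rewrite leq_max ltnS leq_subr orbT.
  rewrite (bigD1 (Ordinal lt)) //= big1 ?addr0.
    by have := hom (e - d)%N; rewrite subnKC // => /pihomog_dE.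
  move=> i ne; apply: (@pihomog_ne0 _ _ _ (d + i)%N _ _ _ (hom i)).
  by apply: contraNneq ne => e'; apply/eqP/val_inj => /=; rewrite -e' addKn.
rewrite mulr0 big1 // => i _; apply: (@pihomog_ne0 _ _ _ (d + i)%N _ _ _ (hom i)).
by rewrite neq_ltn orbC (leq_trans lde) ?leq_addr.
Qed.

Lemma graded_mul_add g d B : g \is d.-homog -> graded B -> graded (mul_add g whole B).
Proof.
move=> hg gB _ e [a [b [_ Bb ->]]]; rewrite raddfD /= (pihomogM _ _ hg).
by eexists; exists (pihomog mdeg e b); split=> //; apply: gB.
Qed.

Lemma graded_mideal Q : graded (mideal Q).
Proof.
move=> p d Qp m /msupp_sum_le/flatten_mapP[m']; rewrite mem_filter => /andP[_ m'p].
by move=> /msuppZ_le; rewrite msuppX mem_seq1 => /eqP->; apply: Qp.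
Qed.

Definition homogeneous p := exists d, p \is d.-homog.

(** A Krull intersection argument by degrees: if [q] is homogeneous of degree [k] and [g q] is in
    [B], then [q] lies in [z ^+ k.+1 S + B], and multiples of [z ^+ k.+1] have no component of
    degree [k]. *)
Lemma wreg_limit gs B (z : S) : ideal B -> graded B -> z \is 1.-homog ->
    (forall g, g \in gs -> homogeneous g) ->
    (forall j, wreg whole (mul_add (z ^+ j) whole B) gs) ->
  wreg whole B gs.
Proof.
move=> + + hz; elim: gs B => //= g gs IH B iB gB hgs w.
have [d hg] := hgs g (mem_head _ _).
split.
  move=> p _ Bgp; rewrite (@pihomog_partitionE _ _ mdeg (msize p) p) //.
  apply: ideal_sum => // k _; set q := pihomog _ _ _.
  have Bgq : B (g * q).
    have := gB _ (d + k)%N Bgp; rewrite (pihomogM _ _ hg) leq_addr.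
    by rewrite addKn.
  have [nz _] := w k.+1.
  have [|a [b [_ Bb e]]] := nz q I; first exact: sub_mul_add.
  have hzk : z ^+ k.+1 \is k.+1.-homog by rewrite -{2}[k.+1]mul1n; apply: dhomogMn.
  have -> : q = pihomog mdeg k q by rewrite pihomog_id.
  rewrite e raddfD /= (pihomogM _ _ hzk) ltnn mulr0 add0r; exact: gB.
apply: IH => //.
- exact: ideal_mul_add.
- exact: graded_mul_add hg gB.
- by move=> h hh; apply: hgs; rewrite inE hh orbT.
- move=> j; refine (iffLR (wreg_eq _ _ _ _) (w j).2);
    try by repeat (apply: ideal_mul_add => //).
  move=> x; split=> -[a [_ [_ [b [c [_ Bc ->]]] ->]]].
    exists b, (g * a + c); split=> //; last by ring.
    by exists a, c.
  exists b, (z ^+ j * a + c); split=> //; last by ring.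
  by exists a, c.
Qed.

End MonomialIdeals.

(** * Elementary symmetric functions of disjoint sums of variables *)

Section SymmetricSequence.
Variables (n : nat) (K : fieldType) (C : {set 'I_n}) (N : 'I_n -> {set 'I_n}).
Hypothesis disjN : forall x y z, x \in C -> y \in C -> z \in N x -> z \in N y -> x = y.
Local Notation S := {mpoly K[n]}.
Implicit Types (T : {set 'I_n}) (gs : seq S) (m : 'X_{1..n}).

Definition nsum x : S := \sum_(y in N x) 'X_y.

Definition elem_sym i : S :=
  \sum_(A : {set 'I_n} | (A \subset C) && (#|A| == i)) \prod_(x in A) nsum x.

Definition elem_syms d := [seq elem_sym i | i <- iota 1 d].

(** The exponents of the monomials in the prime generated by the variables of [T]. *)
Definition meets T m : Prop := exists2 t, t \in T & (0 < m t)%N.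

(** The centres whose sum [nsum x] is nonzero modulo that prime. *)
Definition alive T := [set x in C | ~~ (N x \subset T)].

Lemma elem_symsS d : elem_syms d.+1 = rcons (elem_syms d) (elem_sym d.+1).
Proof. by rewrite /elem_syms -{1}(addn1 d) iotaD map_cat cats1 add1n. Qed.

Lemma elem_sym_homog i : elem_sym i \is i.-homog.
Proof.
apply: rpred_sum => A /andP[_ /eqP<-]; rewrite -sum1_card.
elim/big_rec2: _ => [|x d p _ hp]; first exact: dhomog1.
by apply: dhomogM => //; apply: rpred_sum => y _; rewrite dhomogX; apply/eqP; exact: mdeg1.
Qed.

Lemma elem_syms_homog d g : g \in elem_syms d -> homogeneous g.
Proof. by case/mapP=> i _ ->; exists i; apply: elem_sym_homog. Qed.

Lemma meets_upward T : upward (meets T).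
Proof. by move=> m m' [t tT mt]; exists t; rewrite // mnmDE ltn_addr. Qed.

Lemma meets_setU1 T z m : meets (z |: T) m <-> meets T m \/ (U_(z) <= m)%MM.
Proof.
rewrite lep1mP -lt0n; split.
  by move=> [t /setU1P[->|tT] mt]; [right | left; exists t].
by move=> [[t tT mt]|mz]; [exists t; rewrite // inE tT orbT | exists z; rewrite // setU11].
Qed.

Lemma mul_add_mideal (Q : 'X_{1..n} -> Prop) u (p : S) : upward Q ->
  mul_add 'X_[u] whole (mideal Q) p <-> mideal (fun m => Q m \/ (u <= m)%MM) p.
Proof.
move=> uQ; split.
  have i : ideal (mideal (K := K) (fun m => Q m \/ (u <= m)%MM)).
    apply: ideal_mideal => m m' [Qm|le]; [left; exact: uQ | right].
    exact: lepm_trans le (lem_addr _ _).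
  move=> [a [b [_ Qb ->]]]; apply: (idealD i) => m; last by move=> /Qb Qm; left.
  rewrite mulrC (perm_mem (msuppMX _ _)) => /mapP[m' _ ->].
  by right; apply: lem_addr.
by move=> /mideal_split[a Qa]; exists a, (p - 'X_[u] * a); split=> //; rewrite addrC subrK.
Qed.

Lemma meets_addU T z m : z \notin T -> meets T (m + U_(z))%MM <-> meets T m.
Proof.
move=> zT; split=> [[t tT]|]; last exact: meets_upward.
rewrite mnmDE mnm1E; case: eqP => [e|_]; first by rewrite e tT in zT.
by rewrite addn0 => mt; exists t.
Qed.

(** The ideals [(T) + (z ^+ j)] are treated by induction on [j]: the colon by [z] lowers [j], and
    adding [z] gives the prime of [z |: T]. Then [wreg_limit] applies. *)
Lemma mwreg_meets_setU1 gs T z : z \notin T -> (forall g, g \in gs -> homogeneous g) ->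
  mwreg gs (meets (z |: T)) -> mwreg gs (meets T).
Proof.
move=> zT hgs w; have iT := ideal_mideal K (@meets_upward T).
apply: (@wreg_limit _ _ gs _ 'X_z) => //; first exact: graded_mideal.
  by rewrite dhomogX; apply/eqP; exact: mdeg1.
pose Q j m := meets T m \/ (j <= m z)%N.
have uQ j : upward (Q j).
  move=> m m' [Tm|le]; [left; exact: meets_upward | right].
  by rewrite mnmDE (leq_trans le) ?leq_addr.
move=> j; suff wQ : mwreg gs (Q j).
  have jE m : ((U_(z) *+ j)%MM <= m)%MM = (j <= m z)%N.
    apply/mnm_lepP/idP => [/(_ z)|le i]; rewrite mulmnE mnm1E ?eqxx ?mul1n //.
    by case: eqP => [<-|_]; rewrite ?mul1n ?mul0n.
  refine (iffLR (wreg_eq _ _ _ _) wQ); [exact: ideal_mideal|exact: ideal_mul_add|].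
  move=> p; rewrite mpolyXn; split=> [Qp|/mul_add_mideal Qp m /(Qp (@meets_upward T) m)].
    apply/mul_add_mideal; first exact: meets_upward.
    by move=> m /Qp; rewrite jE.
  by rewrite jE.
elim: j => [|j IH]; first by apply: mwreg_full => //; right.
apply: (@mwreg_colon _ _ _ _ U_(z)) => //.
  apply: mwreg_eq IH => // m; rewrite /Q mnmDE mnm1E eqxx addn1 ltnS.
  by have := meets_addU m zT; tauto.
apply: mwreg_eq w; first exact: meets_upward.
move=> m; rewrite /Q; split=> [/meets_setU1|]; first by tauto.
move=> H; apply/meets_setU1; case: H => [[Tm|le]|]; [by left | right | by right].
by rewrite lep1mP -lt0n; apply: leq_trans le.
Qed.

Lemma nonzerodiv_congr (B : S -> Prop) g h : ideal B -> B (g - h) ->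
  nonzerodiv whole B g -> nonzerodiv whole B h.
Proof.
move=> iB Bgh ng p _ Bhp; apply: (ng _ I).
have -> : g * p = p * (g - h) + h * p by ring.
by apply: idealD => //; apply: idealMl.
Qed.

(** Induction on the number of variables outside [T]. If a variable can be added to [T] with enough
    centres left alive, the larger prime suffices. Otherwise the count is tight, each living sum is
    congruent to one variable modulo [T], and the last symmetric function is congruent to their
    product. *)
Lemma mwreg_meets d T : (d <= #|alive T|)%N -> mwreg (elem_syms d) (meets T).
Proof.
have [k] := ubnP #|~: T|; elim: k d T => // k IH [//|d] T; rewrite ltnS => leTk.
have card_lt z : z \notin T -> (#|~: (z |: T)| < k)%N.
  move=> zT; apply: leq_trans leTk; rewrite [leqRHS](cardsD1 z) inE zT ltnS.
  by apply/subset_leq_card/subsetP => t; rewrite !inE negb_or.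
move=> led; have [[z [zT lez]]|none] :
    (exists z, z \notin T /\ (d < #|alive (z |: T)|)%N) \/
    (forall z, z \notin T -> (#|alive (z |: T)| <= d)%N).
- case: (pickP [pred z | (z \notin T) && (d < #|alive (z |: T)|)%N]) => [z /andP[]|none].
    by move=> zT lez; left; exists z.
  right=> z zT; rewrite leqNgt; apply/negP => lt; have := none z.
  by rewrite /= zT lt.
- apply: (mwreg_meets_setU1 zT); first exact: elem_syms_homog.
  by apply: IH => //; apply: card_lt.
(* By disjointness, adding a variable of [N x] kills no centre but [x]. *)
have alive_sub z x : x \in C -> z \in N x -> alive T :\ x \subset alive (z |: T).
  move=> xC zx; apply/subsetP => y; rewrite !inE => /and3P[yx yC].
  rewrite yC /= => /subsetPn[t ty tT]; apply/subsetPn; exists t => //.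
  rewrite !inE negb_or tT andbT; apply: contraNneq yx => tz.
  by apply/eqP; apply: (disjN yC xC ty); rewrite tz.
have [x0 x0a] : exists x, x \in alive T.
  by apply/set0Pn; rewrite -card_gt0 (leq_trans _ led).
have [z0 z0x z0T] : exists2 z, z \in N x0 & z \notin T.
  by move: x0a; rewrite inE => /andP[_ /subsetPn].
have x0C : x0 \in C by move: x0a; rewrite inE => /andP[].
have card_alive : #|alive T| = d.+1.
  apply/eqP; rewrite eqn_leq led andbT (cardsD1 x0) x0a add1n ltnS.
  by apply: leq_trans (none z0 z0T); apply/subset_leq_card/alive_sub.
have led' z : z \notin T -> (d <= #|alive (z |: T)|)%N.
  move=> zT; case: (boolP [exists x in C, z \in N x]) => [/existsP[x /andP[xC zx]]|].
    apply: leq_trans (subset_leq_card (alive_sub _ _ xC zx)).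
    by have := cardsD1 x (alive T); rewrite card_alive; case: (x \in _) => /= ?; lia.
  rewrite negb_exists => /forallP zN; apply: leq_trans (ltnW led) _.
  apply/subset_leq_card/subsetP => y; rewrite !inE => /andP[yC /subsetPn[t ty tT]].
  rewrite yC; apply/subsetPn; exists t => //; rewrite !inE negb_or tT andbT.
  by apply: contraTneq ty => ->; have := zN y; rewrite yC.
have wz z : z \notin T -> mwreg (elem_syms d) (meets (z |: T)).
  by move=> zT; apply: IH; [exact: card_lt | exact: led'].
have w : mwreg (elem_syms d) (meets T).
  by apply: (mwreg_meets_setU1 z0T (@elem_syms_homog d)); apply: wz.
rewrite elem_symsS /mwreg; apply/wreg_rcons; split=> //.
have iT := ideal_mideal K (@meets_upward T).
set B := mul_addl _ _ _; have iB : ideal B by apply: ideal_mul_addl.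
have TB p : mideal (meets T) p -> B p by apply: sub_mul_addl.
(* The shorter sequence is regular modulo [T] and modulo [z |: T], so the exchange argument applies
   to the variable [z]. *)
have nzX z : z \notin T -> nonzerodiv whole B 'X_z.
  move=> zT; apply: nonzerodiv_mul_addl => //.
    move=> p _ /mideal_mulX Tp m /Tp /meets_addU; exact.
  refine (iffLR (wreg_eq _ _ _ _) (wz _ zT)); [|exact: ideal_mul_add|].
    by apply: ideal_mideal; apply: meets_upward.
  move=> p; split=> [Tp|/mul_add_mideal Tp m /Tp H].
    apply/mul_add_mideal; first exact: meets_upward.
    by move=> m /Tp /meets_setU1.
  by apply/meets_setU1/H/meets_upward.
have X_T t : t \in T -> mideal (meets T) ('X_t : S).
  by move=> tT m /mem_msuppXP<-; exists t; rewrite // mnm1E eqxx.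
have nz_nsum x : x \in alive T -> nonzerodiv whole B (nsum x).
  move=> xa; have xC : x \in C by move: xa; rewrite inE => /andP[].
  have [z zx zT] : exists2 z, z \in N x & z \notin T.
    by move: xa; rewrite inE => /andP[_ /subsetPn].
  (* A second variable of [N x] outside [T] would keep [x] alive after adding [z], against
     tightness. *)
  have sub : N x \subset z |: T.
    apply/negPn/negP => nsub; have := none z zT; rewrite leqNgt => /negP; apply.
    rewrite -card_alive; apply/subset_leq_card/subsetP => y ya.
    have [->|yx] := eqVneq y x; first by rewrite inE xC.
    by apply: (subsetP (alive_sub _ _ xC zx)); rewrite in_setD1 yx.
  apply: nonzerodiv_congr (nzX z zT) => //; apply: TB.
  rewrite /nsum (bigD1 z) //= opprD addNKr; apply: (idealN iT).
  refine (@ideal_sum _ _ _ _ _ _ iT _) => y /andP[yx yz]; apply: X_T.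
  by have := subsetP sub y yx; rewrite !inE (negPf yz).
have nz_prod : nonzerodiv whole B (\prod_(x in alive T) nsum x).
  apply: (big_ind (nonzerodiv whole B)) => //; first by move=> p _; rewrite mul1r.
  exact: nonzerodivM.
apply: nonzerodiv_congr nz_prod => //; apply: TB.
have sC : alive T \subset C by apply/subsetP => x; rewrite inE => /andP[].
(* Every other set of [d.+1] centres contains a dead one, whose sum lies in [(T)]. *)
rewrite /elem_sym (bigD1 (alive T)) /=; last by rewrite sC card_alive eqxx.
rewrite opprD addNKr; apply: (idealN iT); refine (@ideal_sum _ _ _ _ _ _ iT _) => A.
move=> /andP[/andP[AC /eqP cA] neA].
have /subsetPn[x xA xa] : ~~ (A \subset alive T).
  by apply: contra neA => sA; rewrite eqEcard sA card_alive cA leqnn.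
have xT : N x \subset T.
  by move: xa; rewrite inE (subsetP AC _ xA) /= negbK.
rewrite (bigD1 x) //= mulrC; apply: (idealMl _ iT); refine (@ideal_sum _ _ _ _ _ _ iT _) => y yx.
by apply: X_T; apply: (subsetP xT).
Qed.

End SymmetricSequence.

(** * Filtrations of the ideals of a graph *)

Section Graph.
Variables (n : nat) (K : fieldType) (e : rel 'I_n) (C : {set 'I_n}) (d : nat).
Hypotheses (esym : ssrbool.symmetric e) (eirr : irreflexive e).
Local Notation N := (closed_nbhd e).
Hypothesis disjN : forall x y z, x \in C -> y \in C -> z \in N x -> z \in N y -> x = y.
Local Notation S := {mpoly K[n]}.
Implicit Types (T X : {set 'I_n}) (m : 'X_{1..n}) (E L : seq ('I_n * 'I_n)).

Definition nbhd x : {set 'I_n} := [set y | e x y].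

Definition has_edge m : Prop := exists x y, [/\ e x y, 0 < m x & 0 < m y]%N.

(* The monomials of [(T) + I(G)]. *)
Definition edge_meets T m : Prop := meets T m \/ has_edge m.

Local Notation W := (mwreg (@elem_syms n K C N d)).

(** Such an [r] is isolated outside [T], so the branching in [mwreg_edge_meets] never puts it into
    [T], and [x] stays alive. *)
Definition rep T x r := [&& r \in N x, r \notin T & nbhd r \subset T].

Definition kept T x := (x \notin T) || [exists r, rep T x r].

Definition lost T := [set x in C | ~~ kept T x].

Lemma has_edge_upward : upward has_edge.
Proof.
by move=> m m' [x [y [exy mx my]]]; exists x, y; split; rewrite // mnmDE ltn_addr.
Qed.

Lemma edge_meets_upward T : upward (edge_meets T).
Proof.
by move=> m m' [?|?]; [left; apply: meets_upward | right; apply: has_edge_upward].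
Qed.

Lemma meetsU T X m : meets (T :|: X) m <-> meets T m \/ meets X m.
Proof.
split=> [[t /setUP[tT|tX] mt]|[[t tT mt]|[t tX mt]]]; first by left; exists t.
- by right; exists t.
- by exists t; rewrite // inE tT.
- by exists t; rewrite // inE tX orbT.
Qed.

Lemma has_edge_addU y m : has_edge (m + U_(y))%MM <-> has_edge m \/ meets (nbhd y) m.
Proof.
split; last first.
  case=> [|[t]]; first exact: has_edge_upward.
  rewrite inE => eyt mt; exists y, t; split; rewrite // mnmDE ?mnm1E ?eqxx ?addn1 //.
  by rewrite ltn_addr.
move=> [p [q [epq]]]; rewrite !mnmDE !mnm1E.
have [ep|_] := eqVneq y p.
  have [eq|_] := eqVneq y q; first by move: epq; rewrite -ep -eq eirr.
  by rewrite !addn0 => _ mq; right; exists q; rewrite // inE ep.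
have [eq|_] := eqVneq y q; last by rewrite !addn0 => mp mq; left; exists p, q.
by rewrite !addn0 => mp _; right; exists p; rewrite // inE eq esym.
Qed.

Lemma edge_meets_addU T y m : y \notin T ->
  edge_meets (T :|: nbhd y) m <-> edge_meets T (m + U_(y))%MM.
Proof.
move=> yT; rewrite /edge_meets.
by have := has_edge_addU y m; have := meets_addU m yT; have := meetsU T (nbhd y) m; tauto.
Qed.

Lemma lost_sub T : lost T \subset C :&: T.
Proof. by apply/subsetP => x; rewrite !inE negb_or negbK => /and3P[-> ->]. Qed.

(** A centre newly covered is a neighbour of [y], and [y] becomes its representative. An old
    representative is not adjacent to [y], since otherwise [y] would lie in [T]. *)
Lemma lost_setU_nbhd T y : y \notin T -> lost (T :|: nbhd y) \subset lost T.
Proof.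
move=> yT; apply/subsetP => x; rewrite !inE => /andP[-> /=]; apply: contra.
have repU r : rep T x r -> rep (T :|: nbhd y) x r.
  move=> /and3P[rx rT rsub]; apply/and3P; split=> //; last exact: subset_trans (subsetUl _ _).
  rewrite !inE negb_or rT /=; apply: contra yT => eyr.
  by apply: (subsetP rsub); rewrite inE esym.
case/orP=> [xT|/existsP[r /repU rr]]; last by apply/orP; right; apply/existsP; exists r.
have [eyx|neyx] := boolP (e y x); last by apply/orP; left; rewrite !inE negb_or xT neyx.
apply/orP; right; apply/existsP; exists y; apply/and3P; split.
- by rewrite !inE esym eyx orbT.
- by rewrite !inE negb_or yT eirr.
- exact: subsetUr.
Qed.

(** A vertex with a neighbour outside [T] represents no centre, so adding [y] destroys no
    representative. *)
Lemma lost_setU1 T y : y \notin C -> ~~ (nbhd y \subset T) ->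
  lost (y |: T) \subset lost T.
Proof.
move=> yC ny; apply/subsetP => x; rewrite !inE => /andP[xC]; rewrite xC /=; apply: contra.
case/orP=> [xT|/existsP[r /and3P[rx rT rsub]]]; apply/orP.
  by left; rewrite !inE negb_or xT andbT; apply: contraNneq yC => <-.
right; apply/existsP; exists r; apply/and3P; split=> //.
  by rewrite !inE negb_or rT andbT; apply: contraNneq ny => <-.
exact: subset_trans (subsetUr _ _).
Qed.

(** Branching on a variable [y] replaces [T] by [T :|: nbhd y] in the colon and by [y |: T] in the
    sum; for suitable [y] neither loses a further centre. *)
Lemma mwreg_edge_meets T : (#|lost T| + d <= #|C|)%N -> W (edge_meets T).
Proof.
have [k] := ubnP #|~: T|; elim: k T => // k IH T; rewrite ltnS => leTk cT.
have sup_lt X z : T \subset X -> z \notin T -> z \in X -> (#|~: X| < k)%N.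
  move=> TX zT zX; apply: leq_trans leTk; apply/proper_card/properP.
  by split; [rewrite setCS | exists z; rewrite !inE ?zX].
have [/existsP[p /andP[pT np]]|] := boolP [exists p, (p \notin T) && ~~ (nbhd p \subset T)].
  have [q qp qT] := subsetPn np; rewrite inE in qp.
  (* Adjacent vertices are not both centres, so an edge outside [T] has an end which is not a
     centre. *)
  have [y [yT yC ny]] : exists y, [/\ y \notin T, y \notin C & ~~ (nbhd y \subset T)].
    have [pC|pC] := boolP (p \in C); last by exists p.
    exists q; split=> //; last by apply/subsetPn; exists p; rewrite // inE esym.
    apply/negP => qC; have e' : p = q by apply: (disjN (z := q)); rewrite // !inE ?qp ?eqxx ?orbT.
    by move: qp; rewrite e' eirr.
  have [z zy zT] := subsetPn ny.
  apply: (@mwreg_colon _ _ _ _ U_(y)); first exact: edge_meets_upward.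
    apply: mwreg_eq (fun m => edge_meets_addU m yT) _; first exact: edge_meets_upward.
    apply: IH; first by apply: (@sup_lt _ z); rewrite ?subsetUl // inE zy orbT.
    by apply: leq_trans cT; rewrite leq_add2r subset_leq_card ?lost_setU_nbhd.
  apply: (@mwreg_eq _ _ _ (edge_meets (y |: T))); first exact: edge_meets_upward.
    by move=> m; rewrite /edge_meets; have := meets_setU1 T y m; tauto.
  apply: IH; first by apply: (@sup_lt _ y); rewrite ?subsetUr ?setU11.
  by apply: leq_trans cT; rewrite leq_add2r subset_leq_card ?lost_setU1.
rewrite negb_exists => /forallP noedge.
(* With no edge left outside [T] the ideal is the prime of [T], and the centres that are not lost
   are alive. *)
apply: (@mwreg_eq _ _ _ (meets T)); first exact: meets_upward.
  move=> m; split=> [|[//|[p [q [epq mp mq]]]]]; first by left.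
  have := noedge p; rewrite negb_and !negbK => /orP[pT|/subsetP sub]; first by exists p.
  by exists q => //; apply: sub; rewrite inE.
apply: mwreg_meets => //; rewrite -(leq_add2l #|lost T|); apply: leq_trans cT _.
rewrite -leq_subLR -(setIidPr (_ : lost T \subset C)); last first.
  by apply/subsetP => x; rewrite inE => /andP[].
rewrite -cardsD; apply/subset_leq_card/subsetP => x; rewrite !inE.
move=> /andP[+ xC]; rewrite xC /= negbK => /orP[xT|/existsP[r /and3P[rx rT _]]].
  by apply/subsetPn; exists x; rewrite // inE eqxx.
by apply/subsetPn; exists r.
Qed.

Lemma card_centres_nbhd x : (#|C :&: nbhd x| <= 1)%N.
Proof.
apply/card_le1_eqP => y z; rewrite !inE => /andP[yC xy] /andP[zC xz].
by apply: (disjN (z := x)); rewrite // inE esym ?xy ?xz orbT.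
Qed.

(** * Colon ideals by an edge *)

Section Edge.
Variables (a b : 'I_n).
Hypothesis eab : e a b.

(* For [T = set0], the monomials of [I(G)^2 : x_a x_b]. *)
Definition pair_meets T m : Prop :=
  edge_meets T m \/
  exists z w, [/\ e a z, e b w, (z == w) < m z & 0 < m w]%N.

Lemma pair_meets_upward T : upward (pair_meets T).
Proof.
move=> m m' [?|[z [w [az bw mz mw]]]]; [left; exact: edge_meets_upward | right].
by exists z, w; split; rewrite // mnmDE ltn_addr.
Qed.

Lemma pair_meets_setU1 T z m :
  pair_meets (z |: T) m <-> pair_meets T m \/ (U_(z) <= m)%MM.
Proof. by rewrite /pair_meets /edge_meets; have := meets_setU1 T z m; tauto. Qed.

(** The generator [x_z x_w] contributes [x_w] for every [w] in [nbhd b], which absorbs all products.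
    No such [w] is [z], so no square interferes. *)
Lemma pair_meets_addU T z m : z \notin T -> e a z -> ~~ e b z ->
  edge_meets (T :|: nbhd z :|: nbhd b) m <-> pair_meets T (m + U_(z))%MM.
Proof.
move=> zT az bz; have addE := edge_meets_addU m zT.
rewrite /edge_meets meetsU; split.
  move=> [[Tm|[t]]|he].
  - by left; apply/addE; left.
  - rewrite inE => bt mt; right; exists z, t; split=> //; rewrite mnmDE; last exact: ltn_addr.
    rewrite mnm1E; have [et|_] := eqVneq z t; first by move: bz; rewrite et bt.
    by rewrite eqxx addn1.
  - by left; apply/addE; right.
move=> [/addE[Tm|he]|[z' [w [az' bw _]]]]; [by left; left | by right |].
rewrite mnmDE mnm1E; have [ew|_] := eqVneq z w; first by move: bz; rewrite ew bw.
by rewrite addn0 => mw; left; right; exists w; rewrite // inE.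
Qed.

(** Here [z] can be either factor, so all of [nbhd a] and [nbhd b] appear; the square of [x_z]
    contributes [x_z], which is already among them. *)
Lemma pair_meets_addU_triangle T z m : z \notin T -> e a z -> e b z ->
  edge_meets (T :|: (nbhd a :|: nbhd b :|: nbhd z)) m <-> pair_meets T (m + U_(z))%MM.
Proof.
move=> zT az bz; have addE := edge_meets_addU m zT.
rewrite /edge_meets !meetsU; rewrite /edge_meets meetsU in addE; split.
  move=> [[Tm|[[[t]|[t]]|zm]]|he]; try by left; apply/addE; tauto.
  - rewrite inE => at' mt; right; exists t, z; split=> //; rewrite mnmDE mnm1E ?eqxx ?addn1 //.
    by have [_|_] := eqVneq t z; rewrite ?addn1 // ltn_addr.
  - rewrite inE => bt mt; right; exists z, t; split=> //; rewrite mnmDE; last exact: ltn_addr.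
    by rewrite mnm1E eqxx addn1 ltnS; have [->|_] := eqVneq z t.
move=> [/addE|[z' [w [az' bw]]]]; first by tauto.
rewrite !mnmDE !mnm1E => mz' mw; left; right; left.
have [ez|nz] := eqVneq z z'; last first.
  by left; exists z'; rewrite ?inE //; move: mz'; rewrite (negPf nz) addn0; apply: leq_ltn_trans.
have [ew|nw] := eqVneq z w; last first.
  by right; exists w; rewrite ?inE //; move: mw; rewrite (negPf nw) addn0.
by left; exists z; rewrite ?inE //; move: mz'; rewrite -ez -ew eqxx addn1 ltnS.
Qed.

Lemma pair_meets_nbhd T m : nbhd a \subset T -> edge_meets T m <-> pair_meets T m.
Proof.
move=> aT; split=> [|[//|[z [w [az bw mz mw]]]]]; first by left.
by left; exists z; [apply: (subsetP aT); rewrite inE | apply: leq_ltn_trans mz].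
Qed.

(** Packages the addition of the vertices of [X] to [T] one at a time: [br] disposes of the colon
    side at each vertex. *)
Lemma sweep (P : {set 'I_n} -> Prop) T X :
    (forall T' z, T \subset T' -> T' \subset T :|: X -> z \in X -> z \notin T' ->
       P (z |: T') -> P T') ->
  P (T :|: X) -> P T.
Proof.
have [k] := ubnP #|X :\: T|; elim: k T => // k IH T; rewrite ltnS => leXk br PX.
have [/setUidPl <- //|/subsetPn[z zX zT]] := boolP (X \subset T).
apply: (br T z) => //; first exact: subsetUl.
have e1 : z |: T :|: X = T :|: X.
  by rewrite -setUA (setUidPr (_ : [set z] \subset T :|: X)) // sub1set inE zX orbT.
apply: IH.
- apply: leq_trans leXk; apply/proper_card/properP; split; first exact: setDS (subsetUr _ _).
  by exists z; rewrite !inE ?eqxx ?zX ?zT.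
- move=> T' w /subUsetP[_ TT']; rewrite e1; exact: br.
- by rewrite e1.
Qed.

(** All of [nbhd a] is swept into [T]: first the common neighbours of [a] and [b], then the vertices
    that are not centres, last the only possible centre. The final ideal is of the form
    [edge_meets]. *)
Lemma mwreg_pair_meets T : T \subset nbhd a :|: nbhd b ->
    (#|C :&: (T :|: nbhd a)| <= 1)%N -> (#|C :&: (T :|: nbhd b)| <= 1)%N -> (d < #|C|)%N ->
    (forall z, e a z -> e b z -> #|C :&: (nbhd a :|: nbhd b :|: nbhd z)| + d <= #|C|)%N ->
  W (pair_meets T).
Proof.
move=> Tab cTa cTb dC tri; set Z := nbhd a :&: nbhd b.
have Za : Z \subset nbhd a := subsetIl _ _; have Zb : Z \subset nbhd b := subsetIr _ _.
have split_var T' z Q : (forall m, Q m <-> pair_meets T' (m + U_(z))%MM) -> upward Q ->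
    W Q -> W (pair_meets (z |: T')) -> W (pair_meets T').
  move=> QE uQ wQ wz; apply: (@mwreg_colon _ _ _ _ U_(z)); first exact: pair_meets_upward.
    exact: mwreg_eq QE wQ.
  apply: mwreg_eq wz; first exact: pair_meets_upward.
  by move=> m; apply: pair_meets_setU1.
apply: (@sweep (fun T => W (pair_meets T)) T Z).
  move=> T' z TT' T'Z; rewrite !inE => /andP[az bz] zT'.
  apply: (split_var _ _ (edge_meets _)) => [m||]; first exact: pair_meets_addU_triangle.
    exact: edge_meets_upward.
  apply: mwreg_edge_meets; apply: leq_trans (tri _ az bz); rewrite leq_add2r.
  apply: subset_leq_card; apply: subset_trans (lost_sub _) _; apply: setIS.
  rewrite subUset subxx andbT; apply: subset_trans T'Z _; rewrite subUset.
  by rewrite (subset_trans Tab) ?subsetUl //= -setUA subsetU // Za.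
(* The colon ideal has set [T' :|: nbhd z :|: nbhd b]. A centre outside [T :|: nbhd b] is either
   uncovered or represented by [z], so at most one is lost. *)
have lost_branch T' z : Z \subset T' -> C :&: T' \subset T :|: nbhd b ->
    z \in nbhd a -> z \notin T' -> W (pair_meets (z |: T')) -> W (pair_meets T').
  move=> ZT' CT'; rewrite inE => az zT'.
  have bz : ~~ e b z by apply: contra zT' => bz; apply: (subsetP ZT'); rewrite !inE az bz.
  apply: (split_var _ _ (edge_meets _)) => [m||]; first exact: pair_meets_addU.
    exact: edge_meets_upward.
  apply: mwreg_edge_meets; apply: leq_trans dC; rewrite -add1n leq_add2r.
  apply: leq_trans cTb; apply/subset_leq_card/subsetP => x; rewrite [x \in lost _]inE => /andP[xC].
  rewrite inE xC /=; apply: contraR => xTb.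
  have xT' : x \notin T' by apply: contra xTb => xT'; apply: (subsetP CT'); rewrite inE xC.
  have xb : ~~ e b x by move: xTb; rewrite !inE negb_or => /andP[].
  have [zx|zx] := boolP (e z x); last by rewrite /kept !inE !negb_or xT' zx xb.
  apply/orP; right; apply/existsP; exists z; rewrite /rep !inE !negb_or zT' eirr bz esym zx orbT.
  by rewrite /= -setUA setUCA subsetUl.
have Cab x : x \in C -> x \in Z -> x \in T :|: nbhd b.
  by move=> _ /(subsetP Zb) xb; rewrite inE xb orbT.
apply: (@sweep (fun T => W (pair_meets T)) _ (nbhd a :\: C)).
  move=> T' z TT' T'X; rewrite inE => /andP[zC za] zT'; apply: lost_branch => //.
    by apply: subset_trans TT'; apply: subsetUr.
  apply/subsetP => x; rewrite inE => /andP[xC /(subsetP T'X)].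
  by rewrite inE [_ \in _ :\: _]inE xC orbF => /setUP[xT|/Cab->//]; rewrite inE xT.
(* Only a centre [z] can remain to be swept. It is the only centre in [nbhd a], so [T'] has not
   acquired one from there. *)
apply: (@sweep (fun T => W (pair_meets T)) _ (nbhd a)).
  move=> T' z TT' T'X za zT'; apply: lost_branch => //.
    by apply: subset_trans TT'; rewrite setUAC subsetUr.
  have zC : z \in C.
    by apply: contraNT zT' => zC; apply: (subsetP TT'); rewrite inE [_ \in _ :\: _]inE zC za orbT.
  apply/subsetP => x; rewrite inE => /andP[xC xT'].
  have := subsetP T'X x xT'; rewrite 2!inE [_ \in _ :\: _]inE xC orbF.
  case/orP=> [/setUP[xT|/Cab->//]|xa]; first by rewrite inE xT.
  have e1 : x = z by apply: (card_le1_eqP (card_centres_nbhd a)); rewrite inE ?xC ?zC.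
  by move: zT'; rewrite -e1 xT'.
have aT' : nbhd a \subset T :|: Z :|: nbhd a :\: C :|: nbhd a by apply: subsetUr.
apply: mwreg_eq (fun m => pair_meets_nbhd m aT') _; first exact: edge_meets_upward.
apply: mwreg_edge_meets; apply: leq_trans dC; rewrite -add1n leq_add2r.
apply: leq_trans cTa; apply: subset_leq_card; apply: subset_trans (lost_sub _) _.
apply: setIS; rewrite !subUset subsetUl subsetUr /= andbT.
by rewrite (subset_trans Za) ?subsetUr //= (subset_trans (subsetDl _ _)) ?subsetUr.
Qed.

End Edge.

End Graph.

(** * The monomials of the square and their colons by edges *)

Section SquareMonomials.
Variables (n : nat) (e : rel 'I_n).
Hypotheses (esym : ssrbool.symmetric e) (eirr : irreflexive e).
Implicit Types (T X : {set 'I_n}) (m : 'X_{1..n}) (E L : seq ('I_n * 'I_n)).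

Definition edges_prod m : Prop := exists x y z w,
  [/\ e x y, e z w & (U_(x) + U_(y) + (U_(z) + U_(w)) <= m)%MM].

Definition list_edge E m : Prop := exists2 p, p \in E & (0 < m p.1)%N && (0 < m p.2)%N.

(* The monomials of the ideal generated by [I(G)^2] and the edges in [E]. *)
Definition sq_add E m : Prop := edges_prod m \/ list_edge E m.

Lemma edges_prod_upward : upward edges_prod.
Proof.
move=> m m' [x [y [z [w [exy ezw le]]]]]; exists x, y, z, w; split=> //.
exact: lepm_trans le (lem_addr _ _).
Qed.

Lemma sq_add_upward E : upward (sq_add E).
Proof.
move=> m m' [?|[p pE /andP[m1 m2]]]; [left; exact: edges_prod_upward | right].
by exists p; rewrite // !mnmDE !ltn_addr.
Qed.

Lemma edge_neq x y : e x y -> x != y.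
Proof. by move=> exy; apply: contraTneq exy => ->; rewrite eirr. Qed.

Lemma mnm_edge_le x y m : e x y -> (U_(x) + U_(y) <= m)%MM = (0 < m x)%N && (0 < m y)%N.
Proof.
move=> /edge_neq xy; apply/mnm_lepP/andP => [H|[mx my] i].
  have := H x; have := H y; rewrite !mnmDE !mnm1E !eqxx (negPf xy) eq_sym (negPf xy).
  by rewrite addn0 add0n.
rewrite mnmDE !mnm1E; have [<-|_] := eqVneq x i; last by case: eqP => // <-.
by rewrite eq_sym (negPf xy).
Qed.

(** An edge of the product disjoint from [a], [b] divides [m]. If both edges meet [a], [b],
    comparing multiplicities gives an edge dividing [m], or the edges are [a t] and [b v] and
    [x_t x_v] divides [m]. The converse rewrites [ab] times [zw] as [az] times [bw]. *)
Lemma edges_prod_colon a b m : e a b ->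
  edges_prod (m + (U_(a) + U_(b)))%MM <->
  has_edge e m \/ exists z w, [/\ e a z, e b w, (z == w) < m z & 0 < m w]%N.
Proof.
move=> eab; have ab := edge_neq eab; split; last first.
  case=> [[x [y [exy mx my]]]|[z [w [az bw mz mw]]]].
    exists x, y, a, b; split=> //; apply/mnm_lepP => i; rewrite !(mnmDE, mnm1E) leq_add2r.
    have := mnm_edge_le m exy; rewrite mx my => /mnm_lepP/(_ i).
    by rewrite !(mnmDE, mnm1E).
  exists a, z, b, w; split=> //; apply/mnm_lepP => i; rewrite !(mnmDE, mnm1E).
  have : ((z == i) + (w == i) <= m i)%N.
    have [<-|_] := eqVneq z i; first by rewrite eq_sym add1n.
    by have [<-|_] := eqVneq w i.
  by clear; lia.
have neqF (x y : 'I_n) : x != y -> ((x == y) = false) * ((y == x) = false).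
  by move=> xy; rewrite [y == x]eq_sym (negPf xy).
(* Divisibility is stated pointwise, with Booleans as multiplicities, so that [lia] can decide each
   case. *)
pose below (s t u v c c' : 'I_n) := forall i,
  ((s == i) + (t == i) + ((u == i) + (v == i)) <= m i + ((c == i) + (c' == i)))%N.
have outer s t u v : e s t -> below s t u v a b ->
    s != a -> s != b -> t != a -> t != b -> has_edge e m.
  move=> est H sa sb ta tb; exists s, t; split=> //.
    by have := H s; rewrite eqxx !(neqF _ _ sa, neqF _ _ sb); clear; lia.
  by have := H t; rewrite eqxx !(neqF _ _ ta, neqF _ _ tb); clear; lia.
have common c c' t v : e c c' -> e c t -> e c v -> below c t c v c c' -> has_edge e m.
  move=> ecc' ect ecv H; have nc := edge_neq ecc'; have nt := edge_neq ect.
  have nv := edge_neq ecv.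
  have mc : (0 < m c)%N by have := H c; rewrite eqxx !(neqF _ _ nc, neqF _ _ nt, neqF _ _ nv); clear; lia.
  have [et|tc'] := eqVneq t c'; last first.
    by exists c, t; split=> //; have := H t; rewrite eqxx !(neqF _ _ nt, neqF _ _ tc'); clear; lia.
  have [ev|vc'] := eqVneq v c'; last first.
    by exists c, v; split=> //; have := H v; rewrite eqxx !(neqF _ _ nv, neqF _ _ vc'); clear; lia.
  exists c, c'; split=> //; have := H c'; rewrite et ev eqxx !(neqF _ _ nc); clear; lia.
pose G := has_edge e m \/ exists z w, [/\ e a z, e b w, (z == w) < m z & 0 < m w]%N.
have across t v : e a t -> e b v -> below a t b v a b -> G.
  move=> eat ebv H; have nt := edge_neq eat; have nv := edge_neq ebv.
  have [et|tb] := eqVneq t b.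
    left; exists b, v; split=> //.
      by have := H b; rewrite et eqxx !(neqF _ _ ab, neqF _ _ nv); clear; lia.
    have [ev|va] := eqVneq v a.
      by have := H a; rewrite et ev eqxx !(neqF _ _ ab); clear; lia.
    by have := H v; rewrite eqxx !(neqF _ _ va, neqF _ _ nv); clear; lia.
  have [ev|va] := eqVneq v a.
    left; exists a, t; split=> //.
      by have := H a; rewrite ev eqxx !(neqF _ _ ab, neqF _ _ nt); clear; lia.
    by have := H t; rewrite eqxx !(neqF _ _ tb, neqF _ _ nt); clear; lia.
  right; exists t, v; split=> //.
    by have := H t; rewrite eqxx !(neqF _ _ tb, neqF _ _ nt) [v == t]eq_sym; clear; lia.
  by have := H v; rewrite eqxx !(neqF _ _ va, neqF _ _ nv); clear; lia.
move=> [x [y [z [w [exy ezw /mnm_lepP le]]]]]; rewrite -/G.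
have {le} le : below x y z w a b by move=> i; have := le i; rewrite !(mnmDE, mnm1E).
have touch s t : e s t ->
  [\/ exists2 t', e a t' & forall i, ((s == i) + (t == i) = (a == i) + (t' == i))%N,
    exists2 t', e b t' & forall i, ((s == i) + (t == i) = (b == i) + (t' == i))%N |
    [/\ s != a, s != b, t != a & t != b]].
  move=> est; have [es|sa] := eqVneq s a; first by constructor 1; exists t; rewrite -?es.
  have [es|sb] := eqVneq s b; first by constructor 2; exists t; rewrite -?es.
  have [et|ta] := eqVneq t a.
    by constructor 1; exists s => [|i]; rewrite -et ?[e t s]esym // addnC.
  have [et|tb] := eqVneq t b; last by constructor 3.
  by constructor 2; exists s => [|i]; rewrite -et ?[e t s]esym // addnC.
have eba : e b a by rewrite esym.
case: (touch _ _ exy) => [[y' ey' Ey]|[y' ey' Ey]|[xa xb ya yb]]; last first.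
- by left; apply: (outer x y z w).
- case: (touch _ _ ezw) => [[w' ew' Ew]|[w' ew' Ew]|[za zb wa wb]].
  + by apply: (across w' y') => // i; have := le i; rewrite Ey Ew; clear; lia.
  + by left; apply: (common b a y' w') => // i; have := le i; rewrite Ey Ew; clear; lia.
  + by left; apply: (outer z w x y) => // i; have := le i; clear; lia.
- case: (touch _ _ ezw) => [[w' ew' Ew]|[w' ew' Ew]|[za zb wa wb]].
  + by left; apply: (common a b y' w') => // i; have := le i; rewrite Ey Ew; clear; lia.
  + by apply: (across y' w') => // i; have := le i; rewrite Ey Ew; clear; lia.
  + by left; apply: (outer z w x y) => // i; have := le i; clear; lia.
Qed.


Definition linked E x : {set 'I_n} := [set y | ((x, y) \in E) || ((y, x) \in E)].

(** An edge of [E] sharing one end with [ab] contributes its other end; one disjoint from [ab]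
    contributes an edge, already in the colon. *)
Lemma sq_add_colon E a b m : all (fun p => e p.1 p.2) E -> e a b ->
    (a, b) \notin E -> (b, a) \notin E ->
  pair_meets e a b (linked E a :|: linked E b) m <-> sq_add E (m + (U_(a) + U_(b)))%MM.
Proof.
move=> /allP eE eab nab nba; have ab := edge_neq eab.
rewrite /sq_add /pair_meets /edge_meets (edges_prod_colon m eab).
have ba : b != a by rewrite eq_sym.
have ma : (0 < (m + (U_(a) + U_(b)))%MM a)%N by rewrite !mnmDE !mnm1E eqxx addnA addn1 addSn.
have mb : (0 < (m + (U_(a) + U_(b)))%MM b)%N by rewrite !mnmDE !mnm1E eqxx addnA addn1.
have mle t : (0 < m t)%N -> (0 < (m + (U_(a) + U_(b)))%MM t)%N.
  by move=> mt; rewrite mnmDE ltn_addr.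
have mother t : t != a -> t != b -> (m + (U_(a) + U_(b)))%MM t = m t.
  by move=> ta tb; rewrite !mnmDE !mnm1E ![_ == t]eq_sym (negPf ta) (negPf tb) addn0.
split.
  move=> [[[t]|he]|H]; [|by left; left|by left; right].
  rewrite !inE => tE mt; right.
  case/orP: tE => /orP[] tE; eexists; try exact: tE; by rewrite /= ?ma ?mb mle.
move=> [[he|H]|[[x y] xyE /= /andP[mx my]]]; [by left; right|by right|left].
have exy : e x y := eE _ xyE.
have [ex|xa] := eqVneq x a.
  have ya : y != a by rewrite eq_sym -ex edge_neq.
  have yb : y != b by apply: contraNneq nab => <-; rewrite -ex.
  by left; exists y; [rewrite !inE -ex xyE | rewrite -mother].
have [ex|xb] := eqVneq x b.
  have yb : y != b by rewrite eq_sym -ex edge_neq.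
  have ya : y != a by apply: contraNneq nba => <-; rewrite -ex.
  by left; exists y; [rewrite !inE -ex xyE orbT | rewrite -mother].
have [ey|ya] := eqVneq y a.
  by left; exists x; [rewrite !inE -ey xyE !orbT | rewrite -mother].
have [ey|yb] := eqVneq y b.
  by left; exists x; [rewrite !inE -ey xyE !orbT | rewrite -mother].
by right; exists x, y; split; rewrite // -mother.
Qed.

End SquareMonomials.

(** * Regularity modulo the square *)

Section SquareRegular.
Variables (n : nat) (K : fieldType) (e : rel 'I_n) (C : {set 'I_n}) (d : nat).
Hypotheses (esym : ssrbool.symmetric e) (eirr : irreflexive e).
Local Notation N := (closed_nbhd e).
Hypothesis disjN : forall x y z, x \in C -> y \in C -> z \in N x -> z \in N y -> x = y.
Hypothesis ltdC : (d < #|C|)%N.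
Hypothesis triangle_centres : forall a b z, e a b -> e a z -> e b z ->
  (#|C :&: (nbhd e a :|: nbhd e b :|: nbhd e z)| + d <= #|C|)%N.
Implicit Types (T X : {set 'I_n}) (m : 'X_{1..n}) (E L : seq ('I_n * 'I_n)).
Local Notation W := (mwreg (@elem_syms n K C N d)).

Definition avoids E := all (fun p => (p.1 \notin C) && (p.2 \notin C)) E.

(** The colon is the whole ring if [ab] is in [E]. Otherwise [mwreg_pair_meets] needs at most one
    centre in each of [T :|: nbhd e a] and [T :|: nbhd e b]: if [a] or [b] is a centre, it is the
    only one in both neighbourhoods together; if [E] avoids the centres, [T] contains none. *)
Lemma mwreg_sq_add_colon E a b : all (fun p => e p.1 p.2) E -> e a b ->
    [|| a \in C, b \in C | avoids E] ->
  W (fun m => sq_add e E (m + (U_(a) + U_(b)))%MM).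
Proof.
move=> eE eab abC.
have uQ : upward (fun m => sq_add e E (m + (U_(a) + U_(b)))%MM).
  by move=> m m' Qm; rewrite -addmA (addmC m') addmA; apply: sq_add_upward.
have [abE|] := boolP (((a, b) \in E) || ((b, a) \in E)).
  apply: mwreg_full => //; right; have ab := edge_neq eirr eab.
  case/orP: abE => abE; eexists; try exact: abE;
    by rewrite /= !(mnmDE, mnm1E) !eqxx ?addn1 ?addnS.
rewrite negb_or => /andP[nab nba].
set T := linked E a :|: linked E b.
have Tab : T \subset nbhd e a :|: nbhd e b.
  apply/subsetP => t; rewrite !inE => /orP[] /orP[] /(allP eE) /= et;
    by rewrite ?et ?[e _ t]esym ?et ?orbT.
apply: mwreg_eq (fun m => sq_add_colon esym eirr m eE eab nab nba) _.
  exact: pair_meets_upward.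
have ceb : (#|C :&: nbhd e b| <= 1)%N by apply: card_centres_nbhd.
have cea : (#|C :&: nbhd e a| <= 1)%N by apply: card_centres_nbhd.
have centre c c' : c \in C -> e c c' -> C :&: (nbhd e c :|: nbhd e c') \subset [set c].
  move=> cC ec; apply/subsetP => x; rewrite !inE => /andP[xC /orP[cx|cx]].
    have e1 : x = c by apply: (disjN (z := x)); rewrite // inE ?cx ?eqxx ?orbT.
    by rewrite e1.
  by apply/eqP; apply: (disjN (z := c')); rewrite // inE ?ec ?[e x _]esym ?cx orbT.
have [cTa cTb] : (#|C :&: (T :|: nbhd e a)| <= 1)%N /\ (#|C :&: (T :|: nbhd e b)| <= 1)%N.
  have sub c c' : c \in C -> e c c' -> nbhd e c :|: nbhd e c' = nbhd e a :|: nbhd e b ->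
      (#|C :&: (T :|: nbhd e a)| <= 1)%N /\ (#|C :&: (T :|: nbhd e b)| <= 1)%N.
    move=> cC ec eqc; rewrite -(cards1 c); have := centre _ _ cC ec; rewrite eqc => H.
    split; apply: subset_leq_card; apply: subset_trans H; apply: setIS;
      by rewrite subUset Tab ?subsetUl ?subsetUr.
  case/or3P: abC => [aC|bC|avE]; first exact: (sub a b).
    by apply: (sub b a) => //; [rewrite esym | rewrite setUC].
  have T0 : C :&: T = set0.
    apply/setP => x; rewrite !inE; apply/negP => /andP[xC].
    by case/orP=> /orP[] /(allP avE) /=; rewrite xC ?andbF.
  by rewrite !(setIUr _ T) T0 !set0U.
by apply: mwreg_pair_meets => // z az bz; apply: triangle_centres.
Qed.

(** The edges of [L] are adjoined one by one. The condition [avoids] concerns the whole list, hence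
    is stable when an edge passes from [L] to [E]. *)
Lemma mwreg_sq_add_cat E L : all (fun p => e p.1 p.2) (L ++ E) ->
    (forall p, p \in L -> [|| p.1 \in C, p.2 \in C | avoids (L ++ E)]) ->
  W (sq_add e (L ++ E)) -> W (sq_add e E).
Proof.
elim: L E => [//|[a b] L IH] E /= /andP[eab eLE] abC w.
have eE : all (fun p => e p.1 p.2) E by move: eLE; rewrite all_cat => /andP[].
apply: (@mwreg_colon _ _ _ _ (U_(a) + U_(b))%MM); first exact: sq_add_upward.
  apply: mwreg_sq_add_colon => //.
  have /or3P[/= -> //|/= -> |] := abC _ (mem_head _ _); first by rewrite orbT.
  by rewrite /avoids /= all_cat => /and3P[_ _ ->]; rewrite !orbT.
apply: (@mwreg_eq _ _ _ (sq_add e ((a, b) :: E))); first exact: sq_add_upward.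
  move=> m; rewrite /sq_add (mnm_edge_le eirr m eab); split.
    move=> [H|[p]]; first by left; left.
    by rewrite inE => /predU1P[->|pE] mp; [right | left; right; exists p].
  move=> [[H|[p pE mp]]|mab]; first by left.
    by right; exists p; rewrite // inE pE orbT.
  by right; exists (a, b); rewrite ?mem_head.
have perm : perm_eq (L ++ (a, b) :: E) ((a, b) :: L ++ E) by rewrite -cat1s perm_catCA.
apply: IH.
- by rewrite (perm_all _ perm) /= eab.
- move=> p pL; rewrite /avoids (perm_all _ perm).
  by apply: abC; rewrite inE pL orbT.
- apply: mwreg_eq w => [|m]; first exact: sq_add_upward.
  rewrite /sq_add; split=> -[H|[p pE mp]]; try by left.
    by right; exists p; rewrite // (perm_mem perm).
  by right; exists p; rewrite // -(perm_mem perm).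
Qed.

(* The edges avoiding the centres come first: otherwise the colon ideal of such
   an edge could contain two centres at once. *)
Lemma mwreg_edges_prod : W (edges_prod e).
Proof.
pose E0 := [seq p <- enum {: 'I_n * 'I_n} | e p.1 p.2].
pose inC (p : 'I_n * 'I_n) := (p.1 \in C) || (p.2 \in C).
pose E1 := [seq p <- E0 | ~~ inC p]; pose E2 := [seq p <- E0 | inC p].
have E0P p : (p \in E0) = e p.1 p.2 by rewrite mem_filter mem_enum andbT.
have e0 : all (fun p => e p.1 p.2) E0 by apply: filter_all.
have eF (q : pred ('I_n * 'I_n)) : all (fun p => e p.1 p.2) (filter q E0).
  by apply/allP => p; rewrite mem_filter => /andP[_ /(allP e0)].
have e1 := eF (predC inC); have e2 := eF inC.
apply: (@mwreg_eq _ _ _ (sq_add e [::])); first exact: sq_add_upward.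
  by move=> m; split=> [[//|[p //]]|H]; left.
apply: (@mwreg_sq_add_cat _ E1); first by rewrite cats0.
  move=> p _; apply/or3P; constructor 3; rewrite cats0; apply/allP => q.
  by rewrite mem_filter negb_or => /andP[].
rewrite cats0; apply: (@mwreg_sq_add_cat _ E2); first by rewrite all_cat e2.
  by move=> p; rewrite mem_filter orbA => /andP[+ _]; rewrite /inC => ->.
(* With every edge adjoined, the ideal is the edge ideal itself, for which no centre is lost. *)
apply: (@mwreg_eq _ _ _ (edge_meets e set0)); first exact: edge_meets_upward.
  move=> m; split=> [[[t]|[x [y [exy mx my]]]]|]; first by rewrite inE.
    right; exists (x, y); rewrite ?mx ?my // mem_cat /E2 /E1 !(mem_filter _ _ E0) E0P /= exy !andbT.
    exact: orbN.
  move=> [[x [y [z [w [exy _ le]]]]]|[p]].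
    right; exists x, y; have := lepm_trans (lem_addr _ _) le.
    by rewrite (mnm_edge_le eirr m exy) => /andP[].
  rewrite mem_cat /E2 /E1 !(mem_filter _ _ E0) E0P -andb_orl => /andP[_ epp] /andP[m1 m2].
  by right; exists p.1, p.2.
apply: mwreg_edge_meets => //; suff -> : lost e C set0 = set0 by rewrite cards0 ltnW.
by apply/setP => x; rewrite inE /kept !inE /= andbF.
Qed.

End SquareRegular.

(** * Depth of the square of the edge ideal *)

Section EdgeIdealSquare.
Variables (n : nat) (K : fieldType) (e : rel 'I_n).
Hypotheses (esym : ssrbool.symmetric e) (eirr : irreflexive e).
Local Notation S := {mpoly K[n]}.
Implicit Types (p g : S) (gs : seq S).

Lemma ideal_in_ideal gs : ideal (in_ideal gs).
Proof.
split.
- by exists (fun=> 0); rewrite big1 // => i _; rewrite mul0r.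
- move=> _ _ [c ->] [c' ->]; exists (fun i => c i + c' i).
  by rewrite -big_split; apply: eq_bigr => i _; rewrite mulrDl.
- move=> r _ [c ->]; exists (fun i => r * c i).
  by rewrite mulr_sumr; apply: eq_bigr => i _; rewrite mulrA.
Qed.

Lemma mem_in_ideal gs g : g \in gs -> in_ideal gs g.
Proof.
move=> ggs; exists (fun i => (i == index g gs)%:R).
have lt : (index g gs < size gs)%N by rewrite index_mem.
rewrite (bigD1 (Ordinal lt)) //= eqxx mul1r nth_index // big1 ?addr0 // => i ne.
by rewrite (_ : (i : nat) == _ = false) ?mul0r //; apply: contraNF ne => /eqP ei; apply/eqP/val_inj.
Qed.

Lemma edge_monomialsP g :
  reflect (exists x y, e x y /\ g = 'X_[U_(x) + U_(y)]) (g \in edge_monomials K e).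
Proof.
apply: (iffP mapP) => [[[x y]]|[x [y [exy ->]]]].
  by rewrite mem_filter /= => /andP[exy _] ->; exists x, y; rewrite mpolyXD.
exists (x, y); rewrite /= ?mpolyXD // mem_filter /= exy; apply/allpairsP.
by exists (x, y); rewrite !mem_enum.
Qed.

Lemma edge_ideal_sqE p : edge_ideal_sq e p <-> mideal (edges_prod e) p.
Proof.
have up := @edges_prod_upward n e.
split=> [[c ->]|Qp].
  refine (@ideal_sum _ _ _ _ _ _ (ideal_mideal K up) _) => i _; apply: (idealMl _ (ideal_mideal K up)).
  set gs := [seq _ * _ | _ <- _, _ <- _].
  have /allpairsP[[g h] /= [/edge_monomialsP[x [y [exy ->]]]]] :=
    mem_nth 0 (ltn_ord i : (i < size gs)%N).
  move=> /edge_monomialsP[z [w [ezw ->]]] ->; rewrite -mpolyXD => m /mem_msuppXP<-.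
  by exists x, y, z, w; split=> //; apply: lepm_refl.
rewrite [p]mpolyE big_seq; refine (@ideal_sum _ _ _ _ _ _ (ideal_in_ideal _) _) => m /Qp.
move=> [x [y [z [w [exy ezw le]]]]]; rewrite -(submK le) mpolyXD -mul_mpolyC mulrA.
apply: (idealMl _ (ideal_in_ideal _)); apply: mem_in_ideal; rewrite mpolyXD.
by apply: allpairs_f; apply/edge_monomialsP; [exists x, y | exists z, w].
Qed.

(** At most [j.+1] centres are lost on the quotient by the square, and passing from the quotient to
    the ideal gains one. *)
Lemma depth_ge_edge_ideal_sq (C : {set 'I_n}) j :
    (forall x y z, x \in C -> y \in C ->
       z \in closed_nbhd e x -> z \in closed_nbhd e y -> x = y) ->
    (forall a b z, e a b -> e a z -> e b z ->
      #|C :&: (nbhd e a :|: nbhd e b :|: nbhd e z)| <= j.+1)%N ->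
  depth_ge (@edge_ideal_sq n K e) (#|C| - j).
Proof.
move=> disjN tri.
have [/existsP[a /existsP[b eab]]|noedge] := boolP [exists a, exists b, e a b]; last first.
  left=> p /edge_ideal_sqE Qp; apply: msuppnil0; move: Qp; rewrite /mideal; case: (msupp p) => // m s Qp.
  have [x [y [_ [_ [exy _ _]]]]] := Qp m (mem_head _ _).
  by case/negP: noedge; apply/existsP; exists x; apply/existsP; exists y.
right; exists (elem_syms K C (closed_nbhd e) (#|C| - j)).
have up := @edges_prod_upward n e.
have iJ : ideal (@edge_ideal_sq n K e) by apply: ideal_in_ideal.
have hom_gs g : g \in elem_syms K C (closed_nbhd e) (#|C| - j) ->
    exists2 i, (0 < i)%N & g \is i.-homog.
  case/mapP=> i; rewrite mem_iota => /andP[i0 _] ->; exists i => //.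
  exact: elem_sym_homog.
split; first by rewrite size_map size_iota.
split.
  move=> g /hom_gs[i i0 hg]; apply: (dhomog_nemf_coeff hg).
  by rewrite /= mdeg0 eq_sym -lt0n.
apply: regular_seq_wreg => //; last first.
  (* The square is generated in degree 4 and the sequence has positive degrees, so the degree 4
     generator ['X_[u]] survives in the quotient. *)
  pose u := (U_(a) + U_(b) + (U_(a) + U_(b)) : 'X_{1..n})%MM.
  have hu : ('X_[u] : S) \is 4.-homog by rewrite dhomogX /= !mdegD !mdeg1.
  exists 'X_[u]; split.
    by apply/edge_ideal_sqE => m /mem_msuppXP<-; exists a, b, a, b; split=> //; apply: lepm_refl.
  move=> [c [Jc cE]]; have : pihomog mdeg 4 'X_[K, u] = 0.
    rewrite cE raddf_sum big1 // => i _ /=.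
    have [k k0 hk] := hom_gs _ (mem_nth 0 (ltn_ord i)).
    rewrite (pihomogM _ _ hk); case: leqP => // le; last by rewrite mulr0.
    rewrite pihomogE big_seq_cond big1 ?mulr0 // => m /andP[mc /eqP deg].
    have /edge_ideal_sqE/(_ m mc)[x [y [z [w [_ _ lem]]]]] := Jc i (ltn_ord i).
    have := mdegD (m - (U_(x) + U_(y) + (U_(z) + U_(w)))) (U_(x) + U_(y) + (U_(z) + U_(w))).
    by rewrite submK // !mdegD !mdeg1; move: deg; rewrite /=; lia.
  by rewrite (pihomog_dE hu) => /(congr1 (mcoeff u))/eqP; rewrite mcoeffX eqxx mcoeff0 oner_eq0.
case d0E : (#|C| - j)%N => [//|d].
have ltdC : (d < #|C|)%N by lia.
(* The zero ideal is the prime of the empty set of variables, for which all centres are alive. *)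
have i0 : ideal (mideal (K := K) (meets (n := n) set0)).
  by apply: ideal_mideal; apply: meets_upward.
have ie : ideal (mideal (K := K) (edges_prod e)) by apply: ideal_mideal.
have z0 p : mideal (meets set0) p <-> p = 0.
  split=> [Qp|->]; last by move=> m; rewrite msupp0.
  apply: msuppnil0; move: Qp; rewrite /mideal; case: (msupp p) => // m s Qp.
  by have [t] := Qp m (mem_head _ _); rewrite inE.
have iz : ideal (fun p : S => p = 0).
  by split=> // [x y -> ->|r x ->]; rewrite ?addr0 ?mulr0.
rewrite elem_symsS; apply: wreg_ideal_rcons => //.
- by move=> p ->; apply: ideal0.
- refine (iffLR (wreg_eq _ ie iJ _) _) => [p|]; first by have := edge_ideal_sqE p; tauto.
  apply: mwreg_edges_prod => // x y z exy exz eyz.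
  by apply: (@leq_trans (j.+1 + d)); [rewrite leq_add2r tri | lia].
- rewrite -elem_symsS; refine (iffLR (wreg_eq _ i0 iz z0) (_ : mwreg _ _)).
  apply: mwreg_meets => //.
  apply: leq_trans ltdC _; apply/subset_leq_card/subsetP => x xC; rewrite inE xC /=.
  by apply/subsetPn; exists x; rewrite !inE ?eqxx.
Qed.

(** * Centres adjacent to a triangle *)

Section Packing.
Variable C : {set 'I_n}.
Hypothesis disjN : forall x y z,
  x \in C -> y \in C -> z \in closed_nbhd e x -> z \in closed_nbhd e y -> x = y.

Lemma triangle_centres_le3 a b z :
  (#|C :&: (nbhd e a :|: nbhd e b :|: nbhd e z)| <= 3)%N.
Proof.
have c1 x : (#|C :&: nbhd e x| <= 1)%N by apply: card_centres_nbhd.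
rewrite !setIUr (leq_trans (leq_card_setU _ _).1) // -[3%N]/(2 + 1)%N leq_add //.
by rewrite (leq_trans (leq_card_setU _ _).1) // -[2%N]/(1 + 1)%N leq_add.
Qed.

(** Three centres would be distributed one to each vertex of the triangle. Disjointness of closed
    neighbourhoods makes them pairwise nonadjacent and each adjacent to its own vertex only. *)
Lemma triangle_centres_le2 a b z : H_free WK3 e -> e a b -> e a z -> e b z ->
  (#|C :&: (nbhd e a :|: nbhd e b :|: nbhd e z)| <= 2)%N.
Proof.
move=> free eab eaz ebz; rewrite leqNgt; apply/negP => gt2; apply: free.
have c1 x : (#|C :&: nbhd e x| <= 1)%N by apply: card_centres_nbhd.
have sub1 x y : y \in C -> e x y -> C :&: nbhd e x = [set y].
  move=> yC xy; apply/eqP; rewrite eq_sym eqEcard cards1 c1 andbT sub1set !inE yC //.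
have two (A B D : {set 'I_n}) : C :&: A :|: C :&: B :|: C :&: D =
    C :&: (nbhd e a :|: nbhd e b :|: nbhd e z) ->
    (#|C :&: A| <= 1)%N -> (#|C :&: B| <= 1)%N -> C :&: D != set0.
  move=> eq1 cA cB; apply/negP => /eqP D0; move: gt2; rewrite -eq1 D0 setU0 ltnNge => /negP; apply.
  by rewrite (leq_trans (leq_card_setU _ _).1) // -[2%N]/(1 + 1)%N leq_add.
have /set0Pn[x1] : C :&: nbhd e a != set0.
  by apply: (two (nbhd e b) (nbhd e z)); rewrite // !setIUr setUC setUA.
have /set0Pn[x2] : C :&: nbhd e b != set0.
  by apply: (two (nbhd e a) (nbhd e z)); rewrite // !setIUr setUAC.
have /set0Pn[x3] : C :&: nbhd e z != set0.
  by apply: (two (nbhd e a) (nbhd e b)); rewrite // !setIUr.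
rewrite !inE => /andP[C3 z3] /andP[C2 b2] /andP[C1 a1].
have e3 : [set x1; x2; x3] = C :&: (nbhd e a :|: nbhd e b :|: nbhd e z).
  by rewrite !setIUr (sub1 _ _ C1 a1) (sub1 _ _ C2 b2) (sub1 _ _ C3 z3).
rewrite -e3 in gt2.
have card2 (x y : 'I_n) : (#|[set x; y]| <= 2)%N by rewrite cards2; case: (x != y).
have n12 : x1 != x2 by apply: contraTneq gt2 => ->; rewrite setUid -leqNgt.
have n13 : x1 != x3 by apply: contraTneq gt2 => ->; rewrite setUAC setUid -leqNgt.
have n23 : x2 != x3 by apply: contraTneq gt2 => ->; rewrite -setUA setUid -leqNgt.
have nadj x y : x \in C -> y \in C -> x != y -> e x y = false.
  move=> xC yC; apply: contraNF => xy; apply/eqP; apply: (disjN (z := y)) => //.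
    by rewrite inE xy orbT.
  by rewrite inE eqxx.
have nnb v x y : x \in C -> y \in C -> e v x -> x != y -> e v y = false.
  move=> xC yC vx; apply: contraNF => vy; apply/eqP; apply: (disjN (z := v)) => //.
    by rewrite inE esym vx orbT.
  by rewrite inE esym vy orbT.
have nsym (x y : 'I_n) : x != y -> y != x by rewrite eq_sym.
have E := (eab, eaz, ebz, a1, b2, z3, nadj _ _ C1 C2 n12, nadj _ _ C1 C3 n13,
  nadj _ _ C2 C3 n23, nnb _ _ _ C1 C2 a1 n12, nnb _ _ _ C1 C3 a1 n13,
  nnb _ _ _ C2 C1 b2 (nsym _ _ n12), nnb _ _ _ C2 C3 b2 n23,
  nnb _ _ _ C3 C1 z3 (nsym _ _ n13), nnb _ _ _ C3 C2 z3 (nsym _ _ n23)).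
pose f (i : 'I_6) := nth a [:: a; b; z; x1; x2; x3] i.
have fE i k : e (f i) (f k) = WK3 i k.
  case: i k => [[|[|[|[|[|[|//]]]]]] ?] [[|[|[|[|[|[|//]]]]]] ?];
    by rewrite /f /= ?eirr ?E // esym ?E.
exists f; split=> // i k fik.
(* Injectivity holds because adjacency to the three triangle vertices already distinguishes all six
   vertices. *)
have rows l : WK3 i l = WK3 k l by rewrite -!fE fik.
have := rows (inord 0); have := rows (inord 1); have := rows (inord 2).
case: i k {fik rows} => [[|[|[|[|[|[|//]]]]]] ?] [[|[|[|[|[|[|//]]]]]] ?];
  by rewrite /WK3 !inordK // => *; apply: val_inj.
Qed.

End Packing.

Lemma K3_free_triangle a b z : H_free K3 e -> e a b -> e a z -> e b z -> False.
Proof.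
move=> free eab eaz ebz; apply: free.
pose f (i : 'I_3) := nth a [:: a; b; z] i.
have fE i k : e (f i) (f k) = K3 i k.
  case: i k => [[|[|[|//]]] ?] [[|[|[|//]]] ?];
    by rewrite /f /= ?eirr ?eab ?eaz ?ebz // esym ?eab ?eaz ?ebz.
exists f; split=> // i k fik; apply/eqP/negPn/negP => ne.
by have := fE i k; rewrite fik eirr /K3 ne.
Qed.

Lemma alpha2_witness : exists2 C : {set 'I_n}, #|C| = alpha2 e &
  forall x y z, x \in C -> y \in C -> z \in closed_nbhd e x -> z \in closed_nbhd e y -> x = y.
Proof.
have [|C packC maxC] := @eq_bigmax_cond _ [pred C | star_packing e C] (fun C : {set 'I_n} => #|C|).
  by apply/card_gt0P; exists set0; apply/forall_inP => x; rewrite inE.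
exists C => // x y z xC yC zx zy; apply/eqP; apply: contraTT zy => xy.
have /forall_inP/(_ x xC)/forall_inP/(_ y yC) : star_packing e C := packC.
by rewrite xy => /disjointFr ->.
Qed.

End EdgeIdealSquare.

Theorem theorem3p6 (K : fieldType) (n : nat) (e : rel 'I_n) :
  simple_graph e ->
  [/\ depth_ge (@edge_ideal_sq n K e) (alpha2 e - 2),
      (H_free WK3 e -> depth_ge (@edge_ideal_sq n K e) (alpha2 e - 1)) &
      (H_free K3 e -> depth_ge (@edge_ideal_sq n K e) (alpha2 e))].
Proof.
move=> [esym eirr0]; have eirr : irreflexive e by move=> x; apply/negbTE.
have [C <- disjN] := alpha2_witness e; split.
- by apply: depth_ge_edge_ideal_sq => // a b z *; apply: triangle_centres_le3.
- by move=> free; apply: depth_ge_edge_ideal_sq => // a b z *; apply: triangle_centres_le2.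
(* Without triangles the bound on centres is vacuous, so [j = 0] is allowed. *)
- move=> free; rewrite -[#|C|]subn0; apply: depth_ge_edge_ideal_sq => // a b z eab eaz ebz.
  by case: (K3_free_triangle esym eirr free eab eaz ebz).
Qed.
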